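(* Let $(\mathcal{S}_1,\mathcal{S}_2,\mathcal{S}_3)$ be a hypersymplectic or para-hypersymplectic structure on a pre-Courant algebroid $(E,\langle\cdot,\cdot\rangle,\Theta)$, and let $\mathcal{T}_i=\varepsilon_{i-1}\mathcal{S}_{i-1}\mathcal{S}_{i+1}$ (indices in $\mathbb{Z}_3$). Then, for each $i=1,2,3$, the transition morphism $\mathcal{T}_i$ is a Nijenhuis morphism. Moreover: (i) if $\varepsilon_i=-1$, $\mathcal{T}_i$ is a complex structure; (ii) if $\varepsilon_i=1$, $\mathcal{T}_i$ is a para-complex structure.
   Context: Let $E\to M$ be a real vector bundle over a smooth manifold with a fibrewise non-degenerate symmetric bilinear form $\langle\cdot,\cdot\rangle$. A pre-Courant structure $\Theta$ on $(E,\langle\cdot,\cdot\rangle)$ is a pair $(\rho,[\cdot,\cdot])$, where $\rho:E\to TM$ is a vector bundle morphism (anchor) and $[\cdot,\cdot]:\Gamma(E)\times\Gamma(E)\to\Gamma(E)$ is an $\mathbb{R}$-bilinear (not necessarily skew-symmetric) bracket with $\rho(X)\cdot\langle Y,Z\rangle=\langle[X,Y],Z\rangle+\langle Y,[X,Z]\rangle$ and $\rho(X)\cdot\langle Y,Z\rangle=\langle X,[Y,Z]+[Z,Y]\rangle$ for all $X,Y,Z\in\Gamma(E)$. Endomorphisms of $E$ are vector bundle morphisms over $\mathrm{id}_M$; juxtaposition is composition; $\mathcal{I}$ is skew-symmetric if $\langle\mathcal{I}u,v\rangle=-\langle u,\mathcal{I}v\rangle$. The deformation of $\Theta=(\rho,[\cdot,\cdot])$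 by $\mathcal{I}$ is $\Theta_{\mathcal{I}}=(\rho\circ\mathcal{I},[\cdot,\cdot]_{\mathcal{I}})$, $[X,Y]_{\mathcal{I}}=[\mathcal{I}X,Y]+[X,\mathcal{I}Y]-\mathcal{I}[X,Y]$ (again pre-Courant if $\mathcal{I}$ is skew-symmetric), and $\Theta_{\mathcal{I},\mathcal{J}}=(\Theta_{\mathcal{I}})_{\mathcal{J}}$; $c\,\Theta=(c\rho,c[\cdot,\cdot])$ for $c\in\mathbb{R}$. The Nijenhuis torsion is $\mathsf{T}_{\Theta}\mathcal{I}(X,Y)=[\mathcal{I}X,\mathcal{I}Y]-\mathcal{I}([X,Y]_{\mathcal{I}})$, and $\mathcal{I}$ is a Nijenhuis morphism if $\mathsf{T}_{\Theta}\mathcal{I}=0$. A complex (resp. para-complex) structure is an endomorphism $\mathcal{I}$ with $\mathcal{I}^2=-\mathrm{id}_E$ (resp. $\mathcal{I}^2=\mathrm{id}_E$) and $\mathsf{T}_{\Theta}\mathcal{I}=0$. For $\boldsymbol{\varepsilon}=(\varepsilon_1,\varepsilon_2,\varepsilon_3)$, $\varepsilon_i=\pm1$, an $\boldsymbol{\varepsilon}$-hypersymplectic structure on $(E,\Theta)$ is a triplet $(\mathcal{S}_1,\mathcal{S}_2,\mathcal{S}_3)$ of skew-symmetric endomorphisms of $E$ such that (i) $\mathcal{S}_i^2=\varepsilon_i\,\mathrm{id}_E$; (ii) $\mathcal{S}_i\mathcal{S}_j=\varepsilon_1\varepsilon_2\varepsilon_3\,\mathcal{S}_j\mathcal{S}_i$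 for $i\ne j$; (iii) $\Theta_{\mathcal{S}_i,\mathcal{S}_i}=\varepsilon_i\Theta$, for $i,j\in\{1,2,3\}$. Assume $\varepsilon_1\varepsilon_2\varepsilon_3=-1$: it is called hypersymplectic if $\varepsilon_1=\varepsilon_2=\varepsilon_3=-1$, and para-hypersymplectic otherwise; by convention (after a cyclic permutation of indices) para-hypersymplectic structures have $\varepsilon_1=\varepsilon_2=1$, $\varepsilon_3=-1$. Indices are taken in $\mathbb{Z}_3=\{1,2,3\}$. *)

(* Defs.v *)
From HB Require Import structures.
From mathcomp Require Import all_boot all_order all_algebra.
From mathcomp Require Import all_classical all_reals all_analysis.

Set Implicit Arguments.
Unset Strict Implicit.
Unset Printing Implicit Defensive.

Import Order.TTheory GRing.Theory Num.Theory.
Import numFieldNormedType.Exports.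

Local Open Scope classical_set_scope.
Local Open Scope ring_scope.

(* [Ck k A f]: f is of class C^k at every point of the set A, which is open in
   all uses.  C^(k+1) means Fréchet differentiable with a differential of class
   C^k; the vectors v are enough for the latter since the domain is R^n. *)
Fixpoint Ck (R : realType) (n : nat) (W : normedModType R) (k : nat)
    (A : set 'rV[R]_n) (f : 'rV[R]_n -> W) : Prop :=
  match k with
  | 0%N => forall y, A y -> {for y, continuous f}
  | k'.+1 => (forall y, A y -> differentiable f y) /\
             (forall v, Ck k' A (fun y => 'd f y v))
  end.

Definition smooth_on (R : realType) (n : nat) (W : normedModType R)
    (A : set 'rV[R]_n) (f : 'rV[R]_n -> W) : Prop :=
  forall k, Ck k A f.

Lemma diff_linear_comp (R : realType) n (W W' : normedModType R)
    (L : {linear W -> W'}) (f : 'rV[R]_n -> W) y v :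
  continuous L -> differentiable f y -> 'd (L \o f) y v = L ('d f y v).
Proof.
move=> cL df; have dL x : differentiable L x by exact: linear_differentiable.
by rewrite [X in X v]diff_comp //= diff_lin.
Qed.

Section CkTheory.
Variables (R : realType) (n : nat).
Implicit Types (W : normedModType R) (A : set 'rV[R]_n) (k : nat).

Lemma near_eq_diff W (f g : 'rV[R]_n -> W) y :
  (\forall z \near y, f z = g z) -> differentiable f y ->
  differentiable g y /\ 'd g y = 'd f y :> (_ -> _).
Proof.
move=> fg df.
have fgy : f y = g y by exact: nbhs_singleton fg.
have E : g \o shift y = cst (g y) + 'd f y +o_ 0 id.
  have H := diff_locally df.
  apply/eqaddoP => e e0; move/eqaddoP: H => /(_ e e0).
  have fg0 : \forall h \near (0 : 'rV[R]_n), f (h + y) = g (h + y).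
    move: fg; rewrite (near_shift 0 y) /=.
    by apply: filterS => z /=; rewrite subr0.
  by apply: filterS2 fg0 => h /=; rewrite -fgy !fctE /= => ->.
have d : 'd g y = 'd f y :> (_ -> _) by apply: diff_unique E; apply: diff_continuous.
split=> //; apply/diff_locallyP; rewrite d; split=> //; exact: diff_continuous.
Qed.

Lemma near_eq_cont W (f g : 'rV[R]_n -> W) y :
  (\forall z \near y, f z = g z) -> {for y, continuous f} -> {for y, continuous g}.
Proof.
move=> fg cf; rewrite /prop_for /continuous_at -(nbhs_singleton fg).
exact: cvg_trans (near_eq_cvg fg) cf.
Qed.

Lemma Ck_congr W k A (f g : 'rV[R]_n -> W) :
  open A -> {in A, f =1 g} -> Ck k A f -> Ck k A g.
Proof.
move=> oA; have near_fg (W' : normedModType R) (f1 g1 : 'rV[R]_n -> W') y :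
    A y -> {in A, f1 =1 g1} -> \forall z \near y, f1 z = g1 z.
  move=> Ay e; have : nbhs y A by exact: open_nbhs_nbhs.
  by apply: filterS => z /mem_set /e.
elim: k W f g => [|k IH] W f g fg /=.
  by move=> cf y Ay; apply: near_eq_cont (cf y Ay); exact: near_fg.
move=> [df cf]; split=> [y Ay|v].
  by have [] := near_eq_diff (near_fg _ _ _ _ Ay fg) (df _ Ay).
apply: IH (cf v) => y /set_mem Ay.
by have [_ ->] := near_eq_diff (near_fg _ _ _ _ Ay fg) (df _ Ay).
Qed.

Lemma Ck_cover W k A (f : 'rV[R]_n -> W) :
  (forall y, A y -> exists B, B y /\ Ck k B f) -> Ck k A f.
Proof.
elim: k W f => [|k IH] W f H /=.
  by move=> y /H [B [By cB]]; exact: cB.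
split=> [y /H [B [By [dB _]]]|v]; first exact: dB.
by apply: IH => y /H [B [By [_ cB]]]; exists B; split=> //; exact: cB.
Qed.

Lemma Ck_sub W k A B (f : 'rV[R]_n -> W) : A `<=` B -> Ck k B f -> Ck k A f.
Proof. by move=> AB cB; apply: Ck_cover => y /AB By; exists B. Qed.

Lemma CkW W k A (f : 'rV[R]_n -> W) : Ck k.+1 A f -> Ck k A f.
Proof.
elim: k W f => [|k IH] W f [df cf].
  by move=> y /df /differentiable_continuous.
by split=> // v; apply: IH; exact: cf.
Qed.

Lemma Ck_cst W k A (c : W) : Ck k A (fun _ => c).
Proof.
elim: k c => [|k IH] c; first by move=> y _; exact: cst_continuous.
split=> [y _|v]; first exact: differentiable_cst.
rewrite (_ : (fun y => _) = fun=> 0); first exact: IH.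
by apply/funext => y; rewrite [X in X v]diff_cst.
Qed.

Lemma Ck_linear W W' k A (L : {linear W -> W'}) (f : 'rV[R]_n -> W) :
  open A -> continuous L -> Ck k A f -> Ck k A (L \o f).
Proof.
move=> oA cL; have dL x : differentiable L x by exact: linear_differentiable.
elim: k f => [|k IH] f /=.
  by move=> cf y Ay; apply: continuous_comp; [exact: cf|exact: cL].
move=> [df cf]; split=> [y Ay|v].
  by apply: differentiable_comp; [exact: df|exact: dL].
apply: Ck_congr oA _ (IH _ (cf v)) => y /set_mem Ay /=.
by rewrite diff_linear_comp //; exact: df.
Qed.

Lemma Ck_add W k A (f g : 'rV[R]_n -> W) :
  open A -> Ck k A f -> Ck k A g -> Ck k A (f + g).
Proof.
move=> oA; elim: k f g => [|k IH] f g /=.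
  by move=> cf cg y Ay; apply: continuousD; [exact: cf|exact: cg].
move=> [df cf] [dg cg]; split=> [y Ay|v].
  by apply: differentiableD; [exact: df|exact: dg].
apply: Ck_congr oA _ (IH _ _ (cf v) (cg v)) => y /set_mem Ay /=.
by rewrite [X in _ = X v]diffD //; [exact: df|exact: dg].
Qed.

Lemma Ck_mul k A (f g : 'rV[R]_n -> R) :
  open A -> Ck k A f -> Ck k A g -> Ck k A (f * g).
Proof.
move=> oA; elim: k f g => [|k IH] f g.
  by move=> cf cg y Ay; apply: continuousM; [exact: cf|exact: cg].
move=> cf1 cg1; have := cf1; have := cg1.
move=> [dg cg] [df cf]; split=> [y Ay|v].
  by apply: differentiableM; [exact: df|exact: dg].
apply: Ck_congr oA _ (Ck_add oA (IH _ _ (CkW cf1) (cg v)) (IH _ _ (CkW cg1) (cf v))).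
move=> y /set_mem Ay /=.
by rewrite [X in _ = X v]diffM //; [exact: df|exact: dg].
Qed.

Lemma Ck_sum k A m (f : 'I_m -> 'rV[R]_n -> R) :
  open A -> (forall i, Ck k A (f i)) -> Ck k A (fun y => \sum_i f i y).
Proof.
move=> oA cf; rewrite (_ : (fun y => _) = \sum_i f i); last first.
  by apply/funext => y; rewrite fct_sumE.
elim/big_ind : _ => [|g h|i _]; [exact: Ck_cst|exact: Ck_add|exact: cf].
Qed.

Lemma Ck_coord k A m (f : 'rV[R]_n -> 'rV[R]_m) j :
  open A -> Ck k A f -> Ck k A (fun y => f y ord0 j).
Proof.
move=> oA cf.
have lc : linear (fun N : 'rV[R]_m => N ord0 j : R).
  by move=> a u v; rewrite !mxE.
pose cM := GRing.isLinear.Build _ _ _ _ _ lc.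
pose c : {linear 'rV[R]_m -> R} := HB.pack (fun N : 'rV[R]_m => N ord0 j : R) cM.
by apply: (@Ck_linear _ _ _ _ c) => //; exact: coord_continuous.
Qed.

End CkTheory.

Lemma diff_coord (R : realType) n m (f : 'rV[R]_n -> 'rV[R]_m) y v j :
  differentiable f y -> 'd (fun z => f z ord0 j : R) y v = ('d f y v) ord0 j.
Proof.
move=> df.
have lc : linear (fun N : 'rV[R]_m => N ord0 j : R).
  by move=> a u w; rewrite !mxE.
pose cM := GRing.isLinear.Build _ _ _ _ _ lc.
pose c : {linear 'rV[R]_m -> R} := HB.pack (fun N : 'rV[R]_m => N ord0 j : R) cM.
have cc : continuous c by exact: coord_continuous.
exact: (@diff_linear_comp _ _ _ _ c).
Qed.

Lemma linear_row_sum (R : realType) m (W : lmodType R)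
    (L : {linear 'rV[R]_m -> W}) (v : 'rV[R]_m) :
  L v = \sum_i v ord0 i *: L (delta_mx ord0 i).
Proof.
rewrite {1}(row_sum_delta v) linear_sum.
by apply: eq_bigr => i _; rewrite linearZ.
Qed.

Lemma Ck_comp (R : realType) (n m k : nat) (A : set 'rV[R]_n) (B : set 'rV[R]_m)
    (f : 'rV[R]_n -> 'rV[R]_m) (g : 'rV[R]_m -> R) :
  open A -> f @` A `<=` B -> Ck k A f -> Ck k B g -> Ck k A (g \o f).
Proof.
move=> oA fAB; have fB y : A y -> B (f y) by move=> Ay; apply: fAB; exists y.
elim: k g => [|k IH] g.
  move=> cf cg y Ay; apply: continuous_comp; [exact: cf|exact/cg/fB].
move=> cf1 [dg cg]; have [df cf] := cf1; split=> [y Ay|v].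
  by apply: differentiable_comp; [exact: df|exact/dg/fB].
suff H : Ck k A (fun y => \sum_i
    ((fun y => ('d f y v) ord0 i) * ((fun z => 'd g z (delta_mx ord0 i)) \o f)) y).
  apply: Ck_congr oA _ H => y /set_mem Ay.
  rewrite [X in _ = X v]diff_comp /=; [|exact: df|exact/dg/fB].
  exact/esym/linear_row_sum.
apply: (Ck_sum oA) => i; apply: (Ck_mul oA).
  exact: (Ck_coord i oA (cf v)).
by apply: IH; [exact: CkW|exact: cg].
Qed.

(* A homeomorphism from the open set [cdom] of T onto the open subset
   [cmap @` cdom] of R^n, with inverse [cinv]; the values of [cmap] and [cinv]
   outside these two sets are irrelevant. *)
Record chart (R : realType) (n : nat) (T : topologicalType) := Chart {
  cdom : set T;
  cmap : T -> 'rV[R]_n;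
  cinv : 'rV[R]_n -> T;
  cdom_open : open cdom;
  cimage_open : open (cmap @` cdom);
  cmapK : forall x, cdom x -> cinv (cmap x) = x;
  cmap_continuous : forall x, cdom x -> {for x, continuous cmap};
  cinv_continuous : forall y, (cmap @` cdom) y -> {for y, continuous cinv} }.

Record manifold (R : realType) (n : nat) := Manifold {
  mspace :> topologicalType;
  mspace_hausdorff : hausdorff_space mspace;
  mspace_second_countable : @second_countable mspace;
  chart_index : Type;
  atlas : chart_index -> chart R n mspace;
  atlas_cover : forall x, exists a, cdom (atlas a) x;
  atlas_compatible : forall a b,
    smooth_on (cmap (atlas a) @` (cdom (atlas a) `&` cdom (atlas b)))
              (cmap (atlas b) \o cinv (atlas a)) }.

Arguments atlas {R n} _ _.
Arguments atlas_cover {R n} _ _.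

Definition msmooth (R : realType) (n : nat) (M : manifold R n)
    (U : set M) (f : M -> R) : Prop :=
  forall a, smooth_on (cmap (atlas M a) @` (cdom (atlas M a) `&` U))
                      (f \o cinv (atlas M a)).

Section ManifoldTheory.
Variables (R : realType) (n : nat) (M : manifold R n).
Implicit Types (U : set M) (f g : M -> R) (a b c : chart_index M).

Local Notation phi a := (cmap (atlas M a)).
Local Notation psi a := (cinv (atlas M a)).
Local Notation dom a := (cdom (atlas M a)).
Local Notation img a U := (phi a @` (dom a `&` U)).

Lemma img_open a U : open U -> open (img a U).
Proof.
move=> oU; rewrite openE => y [x [ax Ux] xy].
have iy : (phi a @` dom a) y by exists x.
have Uy : U (psi a y) by rewrite -xy cmapK.
have n1 : \forall z \near y, (phi a @` dom a) z.
  by apply: open_nbhs_nbhs; split=> //; exact: cimage_open.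
have n2 : \forall z \near y, U (psi a z).
  have /(_ U) := cinv_continuous iy; apply.
  by apply: open_nbhs_nbhs; split.
apply: filterS2 n1 n2 => z [x' ax' <-]; rewrite cmapK // => Ux'.
by exists x'.
Qed.

Lemma msmooth_congr U f g : open U -> (forall x, U x -> f x = g x) ->
  msmooth U f -> msmooth U g.
Proof.
move=> oU fg sf a k; apply: Ck_congr (sf a k); first exact: img_open.
by move=> y /set_mem [x [ax Ux] <-] /=; rewrite cmapK //; exact: fg.
Qed.

Lemma msmooth_sub U U' f : U `<=` U' -> msmooth U' f -> msmooth U f.
Proof.
move=> UU' sf a k; apply: Ck_sub (sf a k) => y [x [ax Ux] <-].
by exists x => //; split=> //; exact: UU'.
Qed.

Lemma msmooth_cover U f :
  (forall x, U x -> exists U', U' x /\ msmooth U' f) -> msmooth U f.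
Proof.
move=> H a k; apply: Ck_cover => y [x [ax Ux] <-].
have [U' [U'x sf]] := H _ Ux; exists (img a U'); split; last exact: sf.
by exists x.
Qed.

Lemma msmooth_cst U (c : R) : msmooth U (fun=> c).
Proof. by move=> a k; exact: Ck_cst. Qed.

Lemma msmooth_add U f g : open U -> msmooth U f -> msmooth U g ->
  msmooth U (fun x => f x + g x).
Proof.
by move=> oU sf sg a k; apply: (Ck_add _ (sf a k) (sg a k)); exact: img_open.
Qed.

Lemma msmooth_mul U f g : open U -> msmooth U f -> msmooth U g ->
  msmooth U (fun x => f x * g x).
Proof.
by move=> oU sf sg a k; apply: (Ck_mul _ (sf a k) (sg a k)); exact: img_open.
Qed.

Lemma msmooth_sum U m (f : 'I_m -> M -> R) : open U ->
  (forall i, msmooth U (f i)) -> msmooth U (fun x => \sum_i f i x).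
Proof.
move=> oU sf a k.
by apply: Ck_sum => [|i]; [exact: img_open|exact: sf].
Qed.

Lemma transition_differentiable a b x : dom a x -> dom b x ->
  differentiable (phi b \o psi a) (phi a x).
Proof. by move=> ax bx; apply: (atlas_compatible a b 1).1; exists x. Qed.

Lemma near_img a U x : open U -> dom a x -> U x ->
  \forall y \near phi a x, exists x', [/\ dom a x', U x' & phi a x' = y].
Proof.
move=> oU ax Ux; have : nbhs (phi a x) (img a U).
  by apply: open_nbhs_nbhs; split; [exact: img_open|exists x].
by apply: filterS => y [x' [ax' Ux'] <-]; exists x'.
Qed.

Lemma transition_chain a b c x v : dom a x -> dom b x -> dom c x ->
  'd (phi c \o psi b) (phi b x) ('d (phi b \o psi a) (phi a x) v) =
  'd (phi c \o psi a) (phi a x) v.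
Proof.
move=> ax bx cx.
have dab := transition_differentiable ax bx.
have dbc := transition_differentiable bx cx.
have E : (phi b \o psi a) (phi a x) = phi b x by rewrite /= cmapK.
have e : \forall y \near phi a x,
    ((phi c \o psi b) \o (phi b \o psi a)) y = (phi c \o psi a) y.
  have := near_img (cdom_open (atlas M b)) ax bx; apply: filterS.
  by move=> y [x' [ax' bx' <-]] /=; rewrite !cmapK.
have dbc' : differentiable (phi c \o psi b) ((phi b \o psi a) (phi a x)).
  by rewrite E.
have [_ H] := near_eq_diff e (differentiable_comp dab dbc').
apply: etrans (esym (congr1 (@^~ v) H)) => /=.
apply: etrans (esym (congr1 (@^~ v) (diff_comp dab dbc'))) => /=.
by rewrite cmapK.
Qed.

Lemma transition_id a x v : dom a x -> 'd (phi a \o psi a) (phi a x) v = v.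
Proof.
move=> ax.
have e : \forall y \near phi a x, id y = (phi a \o psi a) y.
  have := near_img (cdom_open (atlas M a)) ax ax; apply: filterS.
  by move=> y [x' [ax' _ <-]] /=; rewrite cmapK.
have [did idE] := @is_diff_id _ _ (phi a x).
have [_ H] := near_eq_diff e did.
by apply: etrans (congr1 (@^~ v) H) _; exact: (congr1 (@^~ v) idE).
Qed.

Lemma transition_diff_smooth a b v j :
  msmooth (dom a `&` dom b)
    (fun x => 'd (phi b \o psi a) (phi a x) v ord0 j).
Proof.
move=> c k.
pose G (z : 'rV[R]_n) : R := 'd (phi b \o psi a) z v ord0 j.
have oab : open (img a (dom b)) by apply: img_open; exact: cdom_open.
have oc : open (img c (dom a `&` dom b)).
  by apply: img_open; apply: openI; exact: cdom_open.
apply: (@Ck_comp _ _ _ k _ (img a (dom b)) (phi a \o psi c) G oc).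
- by move=> _ [_ [x [cx [ax bx]] <-] <-]; exists x => //=; rewrite cmapK.
- apply: Ck_sub (atlas_compatible c a k) => _ [x [cx [ax bx]] <-].
  by exists x.
- apply: Ck_coord => //; exact: (atlas_compatible a b k.+1).2.
Qed.

End ManifoldTheory.

(* A vector bundle of rank r, given by its fibres and a family of fibrewise
   linear local trivializations with smooth transition matrices. *)
Record vbundle (R : realType) (n : nat) (M : manifold R n) (r : nat) := VBundle {
  fiber :> M -> lmodType R;
  triv_index : Type;
  tdom : triv_index -> set M;
  triv : forall (a : triv_index) (x : M), {linear fiber x -> 'rV[R]_r};
  triv_inv : forall (a : triv_index) (x : M), {linear 'rV[R]_r -> fiber x};
  tdom_open : forall a, open (tdom a);
  tdom_cover : forall x, exists a, tdom a x;
  trivK : forall a x, tdom a x -> cancel (triv a x) (triv_inv a x);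
  triv_invK : forall a x, tdom a x -> cancel (triv_inv a x) (triv a x);
  triv_smooth : forall a b v j, msmooth (tdom a `&` tdom b)
    (fun x => triv b x (triv_inv a x v) ord0 j) }.

(* The tangent space at x is R^n, a vector being represented by its
   coordinates in a chosen chart around x; its coordinates in the other charts
   are given by the differential of the change of charts. *)
Definition chart_at (R : realType) (n : nat) (M : manifold R n) (x : M) :=
  projT1 (cid (atlas_cover M x)).

Lemma chart_atP (R : realType) (n : nat) (M : manifold R n) (x : M) :
  cdom (atlas M (chart_at x)) x.
Proof. exact: projT2 (cid (atlas_cover M x)). Qed.

Section Tangent.
Variables (R : realType) (n : nat) (M : manifold R n).
Local Notation phi a := (cmap (atlas M a)).
Local Notation psi a := (cinv (atlas M a)).
Local Notation dom a := (cdom (atlas M a)).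

Definition tangent_triv (a : chart_index M) (x : M) :
    {linear 'rV[R]_n -> 'rV[R]_n} :=
  'd (phi a \o psi (chart_at x)) (phi (chart_at x) x).

Definition tangent_triv_inv (a : chart_index M) (x : M) :
    {linear 'rV[R]_n -> 'rV[R]_n} :=
  'd (phi (chart_at x) \o psi a) (phi a x).

Lemma tangent_trivK a x : dom a x ->
  cancel (tangent_triv a x) (tangent_triv_inv a x).
Proof.
move=> ax v; have cx := chart_atP x.
by rewrite /tangent_triv_inv /tangent_triv transition_chain // transition_id.
Qed.

Lemma tangent_triv_invK a x : dom a x ->
  cancel (tangent_triv_inv a x) (tangent_triv a x).
Proof.
move=> ax v; have cx := chart_atP x.
by rewrite /tangent_triv_inv /tangent_triv transition_chain // transition_id.
Qed.

Lemma tangent_triv_smooth a b v j : msmooth (dom a `&` dom b)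
  (fun x => tangent_triv b x (tangent_triv_inv a x v) ord0 j).
Proof.
have := transition_diff_smooth a b v j; apply: msmooth_congr.
  by apply: openI; exact: cdom_open.
move=> x [ax bx].
exact: (congr1 (fun w : 'rV[R]_n => w ord0 j)
  (esym (transition_chain v ax (chart_atP x) bx))).
Qed.

Definition tangent_bundle : vbundle M n :=
  @VBundle R n M n (fun _ => 'rV[R]_n : lmodType R) (chart_index M)
    (fun a => dom a) tangent_triv tangent_triv_inv
    (fun a => cdom_open (atlas M a)) (atlas_cover M)
    tangent_trivK tangent_triv_invK tangent_triv_smooth.

(* The derivative v . f of a function f along a tangent vector v at x. *)
Definition tangent_deriv (x : M) (v : tangent_bundle x) (f : M -> R) : R :=
  'd (f \o psi (chart_at x)) (phi (chart_at x) x) v.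

End Tangent.

Record section (R : realType) (n : nat) (M : manifold R n) (r : nat)
    (E : vbundle M r) := MkSection {
  section_fun :> forall x : M, E x;
  section_smooth : forall (a : triv_index E) j,
    msmooth (tdom a) (fun x => triv a x (section_fun x) ord0 j) }.

Lemma section_eq (R : realType) (n : nat) (M : manifold R n) (r : nat)
    (E : vbundle M r) (X Y : section E) : (forall x, X x = Y x) -> X = Y.
Proof.
case: X Y => [X sX] [Y sY] /= XY.
have {}XY : X = Y by exact: functional_extensionality_dep.
by subst Y; congr MkSection; exact: Prop_irrelevance.
Qed.

Section SectionModule.
Variables (R : realType) (n : nat) (M : manifold R n) (r : nat) (E : vbundle M r).
Implicit Types X Y Z : section E.

Fact zero_smooth (a : triv_index E) j :
  msmooth (tdom a) (fun x => triv a x (0 : E x) ord0 j).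
Proof.
apply: (msmooth_congr (tdom_open a)) (msmooth_cst _ 0) => x _.
by rewrite linear0 mxE.
Qed.
Definition section_zero : section E := MkSection zero_smooth.

Fact add_smooth X Y (a : triv_index E) j :
  msmooth (tdom a) (fun x => triv a x (X x + Y x) ord0 j).
Proof.
apply: (msmooth_congr (tdom_open a)) (msmooth_add (tdom_open a)
  (section_smooth X a j) (section_smooth Y a j)) => x _.
by rewrite linearD mxE.
Qed.
Definition section_add X Y : section E := MkSection (add_smooth X Y).

Fact scale_smooth (c : R) X (a : triv_index E) j :
  msmooth (tdom a) (fun x => triv a x (c *: X x) ord0 j).
Proof.
apply: (msmooth_congr (tdom_open a)) (msmooth_mul (tdom_open a)
  (msmooth_cst _ c) (section_smooth X a j)) => x _.
by rewrite linearZ mxE.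
Qed.
Definition section_scale (c : R) X : section E := MkSection (scale_smooth c X).

Definition section_opp X : section E := section_scale (-1) X.

Fact section_addA : associative section_add.
Proof. by move=> X Y Z; apply: section_eq => x /=; exact: addrA. Qed.
Fact section_addC : commutative section_add.
Proof. by move=> X Y; apply: section_eq => x /=; exact: addrC. Qed.
Fact section_add0 : left_id section_zero section_add.
Proof. by move=> X; apply: section_eq => x /=; exact: add0r. Qed.
Fact section_addN : left_inverse section_zero section_opp section_add.
Proof. by move=> X; apply: section_eq => x /=; rewrite scaleN1r addNr. Qed.

HB.instance Definition _ := gen_eqMixin (section E).
HB.instance Definition _ := gen_choiceMixin (section E).
HB.instance Definition _ := GRing.isZmodule.Build (section E)
  section_addA section_addC section_add0 section_addN.

Fact section_scaleA (a b : R) X :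
  section_scale a (section_scale b X) = section_scale (a * b) X.
Proof. by apply: section_eq => x /=; exact: scalerA. Qed.
Fact section_scale1 : left_id 1 section_scale.
Proof. by move=> X; apply: section_eq => x /=; exact: scale1r. Qed.
Fact section_scaleDr : right_distributive section_scale +%R.
Proof. by move=> a X Y; apply: section_eq => x /=; exact: scalerDr. Qed.
Fact section_scaleDl X : {morph section_scale^~ X : a b / a + b}.
Proof. by move=> a b; apply: section_eq => x /=; exact: scalerDl. Qed.

HB.instance Definition _ := GRing.Zmodule_isLmodule.Build R (section E)
  section_scaleA section_scale1 section_scaleDr section_scaleDl.

Lemma section_addE X Y x : (X + Y) x = X x + Y x. Proof. by []. Qed.
Lemma section_scaleE (c : R) X x : (c *: X) x = c *: X x. Proof. by []. Qed.
Lemma section_oppE X x : (- X) x = - X x.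
Proof. by rewrite -scaleN1r. Qed.

End SectionModule.

(* Vector bundle morphisms over the identity of M, smoothness being that of the
   matrix in local trivializations. *)
Record bundle_hom (R : realType) (n : nat) (M : manifold R n) (r s : nat)
    (E : vbundle M r) (F : vbundle M s) := Hom {
  hom_fun :> forall x : M, {linear E x -> F x};
  hom_smooth : forall (a : triv_index E) (b : triv_index F) v j,
    msmooth (tdom a `&` tdom b)
      (fun x => triv b x (hom_fun x (triv_inv a x v)) ord0 j) }.

Section HomTheory.
Variables (R : realType) (n : nat) (M : manifold R n).

Lemma linear_eq (V W : lmodType R) (f g : {linear V -> W}) :
  f =1 g -> f = g.
Proof.
case: f g => [f [[df] [zf]]] [g [[dg] [zg]]] /= /funext fg; subst g.
by rewrite (Prop_irrelevance df dg) (Prop_irrelevance zf zg).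
Qed.

Lemma hom_eq r s (E : vbundle M r) (F : vbundle M s) (f g : bundle_hom E F) :
  (forall x u, f x u = g x u) -> f = g.
Proof.
case: f g => [f sf] [g sg] /= fg.
have {}fg : f = g.
  by apply: functional_extensionality_dep => x; apply: linear_eq; exact: fg.
by subst g; congr Hom; exact: Prop_irrelevance.
Qed.

Fact hom_section_smooth r s (E : vbundle M r) (F : vbundle M s)
    (f : bundle_hom E F) (X : section E) (b : triv_index F) j :
  msmooth (tdom b) (fun x => triv b x (f x (X x)) ord0 j).
Proof.
apply: msmooth_cover => x bx; have [a ax] := tdom_cover E x.
exists (tdom a `&` tdom b); split=> //.
have oab : open (tdom a `&` tdom b) by apply: openI; exact: tdom_open.
have H : msmooth (tdom a `&` tdom b) (fun x => \sum_i triv a x (X x) ord0 i *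
    triv b x (f x (triv_inv a x (delta_mx ord0 i))) ord0 j).
  apply: msmooth_sum => // i; apply: msmooth_mul => //; last exact: hom_smooth.
  by apply: msmooth_sub (section_smooth X a i) => ? [].
apply: msmooth_congr H => // y [ay _].
rewrite -{2}(trivK ay (X y)).
have := linear_row_sum (triv b y \o f y \o triv_inv a y)%FUN (triv a y (X y)).
move=> /(congr1 (fun w : 'rV[R]_s => w ord0 j)) /= ->.
by rewrite summxE; apply: eq_bigr => i _; rewrite mxE.
Qed.

Definition hom_section r s (E : vbundle M r) (F : vbundle M s)
    (f : bundle_hom E F) (X : section E) : section F :=
  MkSection (hom_section_smooth f X).

Fact hom_id_smooth r (E : vbundle M r) (a b : triv_index E) v j :
  msmooth (tdom a `&` tdom b)
    (fun x => triv b x ((idfun : {linear E x -> E x}) (triv_inv a x v)) ord0 j).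
Proof. exact: triv_smooth. Qed.

Definition hom_id r (E : vbundle M r) : bundle_hom E E := Hom (@hom_id_smooth r E).

Fact hom_comp_smooth r s t (E : vbundle M r) (F : vbundle M s) (G : vbundle M t)
    (f : bundle_hom F G) (g : bundle_hom E F) (a : triv_index E) (b : triv_index G) v j :
  msmooth (tdom a `&` tdom b)
    (fun x => triv b x ((f x \o g x)%FUN (triv_inv a x v)) ord0 j).
Proof.
apply: msmooth_cover => x [ax bx]; have [c cx] := tdom_cover F x.
have oabc : open (tdom a `&` tdom b `&` tdom c).
  by apply: openI; [apply: openI|]; exact: tdom_open.
exists (tdom a `&` tdom b `&` tdom c); split=> //.
have H : msmooth (tdom a `&` tdom b `&` tdom c) (fun x => \sum_i
    triv c x (g x (triv_inv a x v)) ord0 i *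
    triv b x (f x (triv_inv c x (delta_mx ord0 i))) ord0 j).
  apply: msmooth_sum => // i; apply: msmooth_mul => //.
    by apply: msmooth_sub (hom_smooth g a c v i) => ? [[]].
  by apply: msmooth_sub (hom_smooth f c b (delta_mx ord0 i) j) => ? [[]].
apply: msmooth_congr H => // y [_ cy] /=.
set w := g y _; rewrite -{2}(trivK cy w).
have := linear_row_sum (triv b y \o f y \o triv_inv c y)%FUN (triv c y w).
move=> /(congr1 (fun u : 'rV[R]_t => u ord0 j)) /= ->.
by rewrite summxE; apply: eq_bigr => i _; rewrite mxE.
Qed.

Definition hom_comp r s t (E : vbundle M r) (F : vbundle M s) (G : vbundle M t)
    (f : bundle_hom F G) (g : bundle_hom E F) : bundle_hom E G := Hom (hom_comp_smooth f g).

Fact hom_scale_smooth r s (E : vbundle M r) (F : vbundle M s) (c : R)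
    (f : bundle_hom E F) (a : triv_index E) (b : triv_index F) v j :
  msmooth (tdom a `&` tdom b)
    (fun x => triv b x ((c \*: f x) (triv_inv a x v)) ord0 j).
Proof.
have oab : open (tdom a `&` tdom b) by apply: openI; exact: tdom_open.
apply: (msmooth_congr oab) (msmooth_mul oab
  (msmooth_cst _ c) (hom_smooth f a b v j)) => x _ /=.
by rewrite linearZ mxE.
Qed.

Definition hom_scale r s (E : vbundle M r) (F : vbundle M s) (c : R)
    (f : bundle_hom E F) : bundle_hom E F := Hom (hom_scale_smooth c f).

End HomTheory.

Record metric (R : realType) (n : nat) (M : manifold R n) (r : nat)
    (E : vbundle M r) := Metric {
  pairing :> forall x : M, E x -> E x -> R;
  pairing_sym : forall x (u v : E x), pairing u v = pairing v u;
  pairing_linear : forall x c (u v w : E x),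
    pairing (c *: u + v) w = c * pairing u w + pairing v w;
  pairing_nondegenerate : forall x (u : E x),
    (forall v, pairing u v = 0) -> u = 0;
  pairing_smooth : forall (a : triv_index E) u v, msmooth (tdom a)
    (fun x => pairing (x := x) (triv_inv a x u) (triv_inv a x v)) }.

Arguments pairing {R n M r E} _ x _ _.

Section PreCourant.
Variables (R : realType) (n : nat) (M : manifold R n) (r : nat) (E : vbundle M r).

(* A pair (rho, [.,.]) of an anchor and a bracket, without any axiom. *)
Record anchored_bracket := AnchoredBracket {
  anchor : bundle_hom E (tangent_bundle M);
  bracket : section E -> section E -> section E }.

Implicit Types (g : metric E) (Theta : anchored_bracket) (I J : bundle_hom E E).

Definition pair_sections g (X Y : section E) : M -> R := fun x => g x (X x) (Y x).

Definition anchor_deriv Theta (X : section E) (f : M -> R) : M -> R :=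
  fun x => tangent_deriv (anchor Theta x (X x)) f.

Definition pre_courant g Theta : Prop :=
  [/\ forall (c : R) X Y Z,
        bracket Theta (c *: X + Y) Z = c *: bracket Theta X Z + bracket Theta Y Z,
      forall (c : R) X Y Z,
        bracket Theta X (c *: Y + Z) = c *: bracket Theta X Y + bracket Theta X Z,
      forall X Y Z x, anchor_deriv Theta X (pair_sections g Y Z) x =
        pair_sections g (bracket Theta X Y) Z x +
        pair_sections g Y (bracket Theta X Z) x &
      forall X Y Z x, anchor_deriv Theta X (pair_sections g Y Z) x =
        pair_sections g X (bracket Theta Y Z + bracket Theta Z Y) x].

Definition skew_symmetric g I : Prop :=
  forall x (u v : E x), g x (I x u) v = - g x u (I x v).

Definition deform Theta I : anchored_bracket :=
  AnchoredBracket (hom_comp (anchor Theta) I)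
    (fun X Y => bracket Theta (hom_section I X) Y
              + bracket Theta X (hom_section I Y)
              - hom_section I (bracket Theta X Y)).

Definition scale_bracket (c : R) Theta : anchored_bracket :=
  AnchoredBracket (hom_scale c (anchor Theta)) (fun X Y => c *: bracket Theta X Y).

Definition torsion Theta I (X Y : section E) : section E :=
  bracket Theta (hom_section I X) (hom_section I Y)
  - hom_section I (bracket (deform Theta I) X Y).

Definition nijenhuis Theta I : Prop := forall X Y, torsion Theta I X Y = 0.

Definition complex_structure Theta I : Prop :=
  hom_comp I I = hom_scale (-1) (hom_id E) /\ nijenhuis Theta I.

Definition para_complex_structure Theta I : Prop :=
  hom_comp I I = hom_id E /\ nijenhuis Theta I.

(* The indices 1, 2, 3 are the elements of 'Z_3, where 3 = 0. *)
Definition eps_hypersymplectic g Theta (eps : 'Z_3 -> R) (S : 'Z_3 -> bundle_hom E E)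
    : Prop :=
  [/\ forall i, eps i = 1 \/ eps i = -1,
      forall i, skew_symmetric g (S i),
      forall i, hom_comp (S i) (S i) = hom_scale (eps i) (hom_id E),
      forall i j, i != j -> hom_comp (S i) (S j) =
        hom_scale (eps 1 * eps 2 * eps 3) (hom_comp (S j) (S i)) &
      forall i, deform (deform Theta (S i)) (S i) = scale_bracket (eps i) Theta].

Definition hypersymplectic g Theta (eps : 'Z_3 -> R) (S : 'Z_3 -> bundle_hom E E)
    : Prop :=
  eps_hypersymplectic g Theta eps S /\ forall i, eps i = -1.

(* Up to a cyclic permutation of the indices, (eps 1, eps 2, eps 3) is (1, 1, -1). *)
Definition para_hypersymplectic g Theta (eps : 'Z_3 -> R)
    (S : 'Z_3 -> bundle_hom E E) : Prop :=
  [/\ eps_hypersymplectic g Theta eps S, eps 1 * eps 2 * eps 3 = -1 &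
      ~ forall i, eps i = -1].

Definition transition (eps : 'Z_3 -> R) (S : 'Z_3 -> bundle_hom E E) (i : 'Z_3)
    : bundle_hom E E :=
  hom_scale (eps (i - 1)) (hom_comp (S (i - 1)) (S (i + 1))).

End PreCourant.

(* Main.v *)
(* If [I^2 = e id], the double deformation of a bracket by [I] equals [e] times the
   bracket plus twice the torsion of [I], so condition (iii) says that every [S i]
   is Nijenhuis.  For anticommuting [I] and [J] with [I^2 = e id], [J^2 = f id] and
   zero torsions, bilinearity of the bracket alone gives
     T(IJ)(X, Y) = f [IX, IY] - e [JX, JY] - IJ ([IX, JY] + [JX, IY]);
   the right-hand side is odd and the left-hand side even under the exchange of [I]
   and [J], hence the torsion of [IJ] vanishes. *)
Require Import Defs.
From HB Require Import structures.
From mathcomp Require Import all_boot all_order all_algebra.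
From mathcomp Require Import all_classical all_reals all_analysis.

Set Implicit Arguments.
Unset Strict Implicit.
Unset Printing Implicit Defensive.

Import Order.TTheory GRing.Theory Num.Theory.
Local Open Scope ring_scope.

(** * Torsion of linear operators for a bilinear bracket *)

Section BilinearTorsion.
Variables (R : numFieldType) (V : lmodType R) (B : V -> V -> V).
Hypothesis linBl : forall Y, linear (B^~ Y).
Hypothesis linBr : forall X, linear (B X).

(** The bracket [C] is an argument so that the deformation can be iterated. *)
Definition deform_op (C : V -> V -> V) (I : V -> V) (X Y : V) : V :=
  C (I X) Y + C X (I Y) - I (C X Y).

Definition torsion_op (I : V -> V) (X Y : V) : V :=
  B (I X) (I Y) - I (deform_op B I X Y).

Lemma addvv_eq0 (v : V) : v + v = 0 -> v = 0.
Proof.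
by move=> /eqP; rewrite -mulr2n -scaler_nat scaler_eq0 pnatr_eq0 => /eqP.
Qed.

Let BZl c X Y : B (c *: X) Y = c *: B X Y.
Proof.
have B0 : B 0 Y = 0.
  by have := linBl Y (-1) 0 0; rewrite scaler0 addr0 scaleN1r addNr.
by have := linBl Y c X 0; rewrite /= B0 !addr0.
Qed.

Let BZr c X Y : B X (c *: Y) = c *: B X Y.
Proof.
have B0 : B X 0 = 0.
  by have := linBr X (-1) 0 0; rewrite scaler0 addr0 scaleN1r addNr.
by have := linBr X c Y 0; rewrite /= B0 !addr0.
Qed.

Let BNl X Y : B (- X) Y = - B X Y.
Proof. by rewrite -scaleN1r BZl scaleN1r. Qed.

Let BNr X Y : B X (- Y) = - B X Y.
Proof. by rewrite -scaleN1r BZr scaleN1r. Qed.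

(** Torsion is quadratic in the operator, so a sign cancels. *)
Lemma torsion_opN (I : {linear V -> V}) X Y :
  torsion_op (fun Z => - I Z) X Y = torsion_op I X Y.
Proof.
by rewrite /torsion_op /deform_op /= !BNl !BNr -!opprD linearN !opprK linearN.
Qed.

Lemma deform_op2_torsion_op (I : {linear V -> V}) (e : R) X Y :
  (forall Z, I (I Z) = e *: Z) ->
  deform_op (deform_op B I) I X Y =
    torsion_op I X Y + torsion_op I X Y + e *: B X Y.
Proof.
move=> II; rewrite /torsion_op {1}/deform_op.
set D := I (deform_op B I X Y).
have DE : D = I (B (I X) Y) + I (B X (I Y)) - e *: B X Y.
  by rewrite /D /deform_op linearB linearD /= II.
(* Only one of the three copies of [D] is expanded; a folded copy stays on each side, and the seven
   terms then match. *)
rewrite {2}DE /deform_op !II BZl BZr !opprD opprK.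
rewrite [LHS](AC (3*3*1) (2*3*6*1*4*7*5)) /=.
by rewrite [RHS](AC (1*3*2*1) (1*2*3*4*5*6*7)) /=.
Qed.

Lemma torsion_op_eq0 (I : {linear V -> V}) (e : R) X Y :
  (forall Z, I (I Z) = e *: Z) ->
  deform_op (deform_op B I) I X Y = e *: B X Y -> torsion_op I X Y = 0.
Proof.
move=> II; rewrite (deform_op2_torsion_op _ _ II) -[RHS]add0r => /addIr.
exact: addvv_eq0.
Qed.

(** Serves as a rewrite rule that pulls [I] out of a bracket. *)
Lemma torsion_op0E (I : {linear V -> V}) (e : R) X Y :
  (forall Z, I (I Z) = e *: Z) -> torsion_op I X Y = 0 ->
  B (I X) (I Y) = I (B (I X) Y) + I (B X (I Y)) - e *: B X Y.
Proof.
by move=> II /eqP; rewrite subr_eq0 => /eqP ->; rewrite linearB linearD /= II.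
Qed.

Section AnticommutingPair.
Variables (I J : {linear V -> V}) (e f : R).
Hypothesis II : forall Z, I (I Z) = e *: Z.
Hypothesis JJ : forall Z, J (J Z) = f *: Z.
Hypothesis JI : forall Z, J (I Z) = - I (J Z).
Hypothesis tI : forall X Y, torsion_op I X Y = 0.
Hypothesis tJ : forall X Y, torsion_op J X Y = 0.

Lemma torsion_op_compE X Y :
  torsion_op (I \o J) X Y = f *: B (I X) (I Y) - e *: B (J X) (J Y)
    - I (J (B (I X) (J Y) + B (J X) (I Y))).
Proof.
have EI U W := torsion_op0E II (tI U W).
have EJ U W := torsion_op0E JJ (tJ U W).
(* Zero torsion of [J] at [(I X, Y)], after anticommuting [J] past [I]; [M] is the same at
   [(X, I Y)]. *)
have L : B (I (J X)) (J Y)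
    = J (B (I (J X)) Y) - J (B (I X) (J Y)) + f *: B (I X) Y.
  apply: oppr_inj; rewrite -BNl -JI EJ JI BNl linearN.
  by rewrite !opprD opprK.
have M : B (J X) (I (J Y))
    = J (B X (I (J Y))) - J (B (J X) (I Y)) + f *: B X (I Y).
  apply: oppr_inj; rewrite -BNr -JI EJ JI BNr linearN.
  by rewrite !opprD opprK [- _ + _]addrC.
have KK Z : I (J (I (J Z))) = - ((e * f) *: Z).
  by rewrite JI linearN II JJ scalerA.
rewrite /torsion_op /deform_op /= [B (I (J X)) (I (J Y))]EI L M.
rewrite [in RHS](EI X Y).
rewrite !(linearB, linearD, linearN, linearZ) /= KK.
rewrite !scalerN !scalerA [f * e]mulrC.
set W := - (e *: B (J X) (J Y)); rewrite !opprK.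
(* The last two pairs cancel: the terms [I (J (B (I (J X)) Y))] and [I (J (B X (I (J Y))))] with
   their opposites. *)
rewrite [LHS](AC ((3*3)*1*3) ((3*6*10*7*(2*5))*((1*8)*(4*9)))) /=.
by rewrite !subrr !addr0.
Qed.

End AnticommutingPair.

Lemma torsion_op_comp0 (I J : {linear V -> V}) (e f : R) :
  (forall Z, I (I Z) = e *: Z) -> (forall Z, J (J Z) = f *: Z) ->
  (forall Z, J (I Z) = - I (J Z)) ->
  (forall X Y, torsion_op I X Y = 0) -> (forall X Y, torsion_op J X Y = 0) ->
  forall X Y, torsion_op (I \o J) X Y = 0.
Proof.
move=> II JJ JI tI tJ X Y; apply: addvv_eq0.
have IJ Z : I (J Z) = - J (I Z) by rewrite JI opprK.
have K : J \o I = (fun Z => - (I \o J) Z) by apply/funext => Z /=.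
have := torsion_op_compE JJ II IJ tJ tI X Y.
(* The two copies of the torsion get different expressions, one with [I] and [J] exchanged; these
   are opposite. *)
rewrite K (torsion_opN (I \o J)%FUN) => {2}->.
rewrite (torsion_op_compE II JJ JI tI tJ) JI opprK [B (J X) (I Y) + _]addrC.
by rewrite addrACA addNr addr0 addrA subrK subrr.
Qed.

End BilinearTorsion.

(** * Bundle endomorphisms as linear operators on sections *)

Section HomSection.
Variables (R : realType) (n r : nat) (M : manifold R n) (E : vbundle M r).

Fact hom_section_is_linear (I : bundle_hom E E) : linear (hom_section I).
Proof. by move=> c X Y; apply: section_eq => x /=; rewrite linearP. Qed.

HB.instance Definition _ (I : bundle_hom E E) :=
  GRing.isLinear.Build R (section E) (section E) *:%R (hom_section I)
    (hom_section_is_linear I).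

Lemma hom_section_comp (I J : bundle_hom E E) :
  hom_section (hom_comp I J) = hom_section I \o hom_section J.
Proof. by apply/funext => X; apply: section_eq. Qed.

Lemma hom_section_scale (c : R) (I : bundle_hom E E) X :
  hom_section (hom_scale c I) X = c *: hom_section I X.
Proof. exact: section_eq. Qed.

Lemma hom_section_id X : hom_section (hom_id E) X = X.
Proof. exact: section_eq. Qed.

Lemma hom_scale1 (I : bundle_hom E E) : hom_scale 1 I = I.
Proof. by apply: hom_eq => x u /=; rewrite scale1r. Qed.

End HomSection.

(** * Index arithmetic modulo 3 *)

Section CyclicIndices.
Variables (R : comPzRingType) (eps : 'Z_3 -> R).

(** The three indices on the left exhaust ['Z_3], where [3] is [0]. This makes the sign condition
    available at every [i]. *)
Lemma prod_cyclic_Z3 (i : 'Z_3) :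
  eps (i - 1) * eps (i + 1) * eps i = eps 1 * eps 2 * eps 3.
Proof.
have [E0 E1 E2 E3] :
    [/\ (- 1 : 'Z_3) = 2, (3 : 'Z_3) = 0, (2 - 1 : 'Z_3) = 1 & (2 + 1 : 'Z_3) = 0].
  by split; exact: val_inj.
have [->|->|->] : [\/ i = 0, i = 1 | i = 2].
- case: i => [[|[|[|//]]] p].
  + by constructor 1; exact: val_inj.
  + by constructor 2; exact: val_inj.
  + by constructor 3; exact: val_inj.
- by rewrite !add0r E0 E1 [eps 2 * _]mulrC.
- by rewrite subrr E1 [LHS](AC 3 (3*2*1)).
- by rewrite E2 E3 E1 mulrAC.
Qed.

Lemma neighbours_neq_Z3 (i : 'Z_3) : i - 1 != i + 1.
Proof. by case: i => [[|[|[|//]]] p]. Qed.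

End CyclicIndices.

Theorem theorem5p2 (R : realType) (n r : nat) (M : manifold R n)
    (E : vbundle M r) (g : metric E) (Theta : anchored_bracket E)
    (eps : 'Z_3 -> R) (S : 'Z_3 -> bundle_hom E E) :
  pre_courant g Theta ->
  hypersymplectic g Theta eps S \/ para_hypersymplectic g Theta eps S ->
  forall i : 'Z_3,
    nijenhuis Theta (transition eps S i) /\
    (eps i = -1 -> complex_structure Theta (transition eps S i)) /\
    (eps i = 1 -> para_complex_structure Theta (transition eps S i)).
Proof.
move=> [Bl Br _ _] hyp i.
have [[eps1 _ SS SC defS] prodN1] :
    eps_hypersymplectic g Theta eps S /\ eps 1 * eps 2 * eps 3 = -1.
  by case: hyp => [[? e]|[]//]; split=> //; rewrite !e mulrNN mulr1 mul1r.
have linBl Y : linear (bracket Theta ^~ Y) by move=> c X Z; exact: Bl.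
have linBr X : linear (bracket Theta X) by move=> c Y Z; exact: Br.
have sqS j Z : hom_section (S j) (hom_section (S j) Z) = eps j *: Z.
  have := congr1 (fun I => hom_section I Z) (SS j).
  by rewrite /= hom_section_comp hom_section_scale hom_section_id.
have torS j X Y : torsion_op (bracket Theta) (hom_section (S j)) X Y = 0.
  apply: (torsion_op_eq0 linBl linBr (sqS j)).
  (* The bracket of [deform] is convertible to [deform_op] on sections. *)
  exact: (congr1 (fun T => bracket T X Y) (defS j)).
set a := i - 1; set b := i + 1.
have ab : a != b by exact: neighbours_neq_Z3.
have SbSa Z : hom_section (S b) (hom_section (S a) Z)
    = - hom_section (S a) (hom_section (S b) Z).
  have ba : b != a by rewrite eq_sym.
  have := congr1 (fun I => hom_section I Z) (SC _ _ ba).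
  by rewrite /= prodN1 hom_section_scale !hom_section_comp scaleN1r.
have nijT : nijenhuis Theta (transition eps S i).
  move=> X Y.
  have := torsion_op_comp0 linBl linBr (sqS a) (sqS b) SbSa (torS a) (torS b) X Y.
  rewrite -[RHS]/(0 : section E) => t0.
  rewrite -[LHS]/(torsion_op (bracket Theta)
    (hom_section (transition eps S i)) X Y).
  have K c : hom_section (hom_scale c (hom_comp (S a) (S b)))
      = (fun Z => c *: (hom_section (S a) \o hom_section (S b)) Z).
    by apply/funext => Z; rewrite hom_section_scale hom_section_comp.
  (* The factor [eps a] is a sign, and torsion is even in the operator. *)
  rewrite K; have [->|->] := eps1 a.
    by rewrite (_ : (fun Z => _) = hom_section (S a) \o hom_section (S b)) //;
       apply/funext => Z; rewrite scale1r.
  rewrite (_ : (fun Z => _) =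
    fun Z => - (hom_section (S a) \o hom_section (S b)) Z).
    by rewrite (torsion_opN linBl linBr (hom_section (S a) \o hom_section (S b))%FUN).
  by apply/funext => Z; rewrite scaleN1r.
(* Anticommutation turns the square into $-\varepsilon_a^2\,\mathcal{S}_a^2\mathcal{S}_b^2 =
   -\varepsilon_a\varepsilon_b$ times the identity, which is $\varepsilon_i$ because the three signs
   have product $-1$. *)
have sqT : hom_comp (transition eps S i) (transition eps S i)
    = hom_scale (eps i) (hom_id E).
  have p : eps a * eps b * eps i = -1 by rewrite prod_cyclic_Z3.
  apply: hom_eq => x u /=.
  have SSx j v : S j x (S j x v) = eps j *: v.
    by have := congr1 (fun I : bundle_hom E E => I x v) (SS j).
  have SCx v : S b x (S a x v) = - S a x (S b x v).
    have ba : b != a by rewrite eq_sym.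
    have := congr1 (fun I : bundle_hom E E => I x v) (SC _ _ ba).
    by rewrite /= prodN1 scaleN1r.
  rewrite !linearZ /= SCx !linearN SSx linearZ /= SSx !scalerA -scaleNr.
  rewrite scalerA -/a; congr (_ *: _).
  by move: p; have [->|->] := eps1 a; have [->|->] := eps1 b;
    rewrite !(mulrN, mulNr, mulr1, mul1r, opprK) => /eqP;
    rewrite ?eqr_opp => /eqP ->.
by split=> //; split=> ei; split=> //; rewrite sqT ei ?hom_scale1.
Qed.
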